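(* Let $n\ge 2$ be an integer and let $\mathcal{X}$ be a $2$-dimensional polyhedral Banach space (that is, $\mathbb{R}^2$ with a polyhedral norm) whose closed unit ball $B_{\mathcal{X}}$ is the regular $2n$-gon with vertices $\left(\cos\frac{(j-1)\pi}{n},\ \sin\frac{(j-1)\pi}{n}\right)$, $j\in\{1,2,\ldots,2n\}$. Then $$\eta_{dw}(\mathcal{X})=\begin{cases}\sqrt{\sin^2\frac{\pi}{2n}+1}, & \text{when } n \text{ is odd},\\ \sqrt{\tan^2\frac{\pi}{2n}+1}, & \text{when } n \text{ is even}.\end{cases}$$
   Context: A finite-dimensional real Banach space is polyhedral if its closed unit ball has finitely many extreme points. $\mathcal{L}(\mathcal{X})$ is the space of bounded linear operators on $\mathcal{X}$ with the operator norm, and $S_{\mathcal{L}(\mathcal{X})}$ is its unit sphere; $\mathcal{X}^*$ is the dual; $S_{\mathcal{X}}=\{x:\|x\|=1\}$. For $x\in S_{\mathcal{X}}$ put $\mathcal{J}(x)=\{f\in\mathcal{X}^*: f(x)=1=\|f\|\}$, and $\Pi=\{(x,f): x\in S_{\mathcal{X}}, f\in\mathcal{J}(x)\}$. The Davis-Wielandt radius of $T$ is $dw(T)=\sup\left\{\sqrt{|x^*(Tx)|^2+\|Tx\|^4}:(x,x^* )\in\Pi\right\}$ and the Davis-Wielandt index of $\mathcal{X}$ is $\eta_{dw}(\mathcal{X})=\inf\{dw(T):T\in S_{\mathcal{L}(\mathcal{X})}\}$. *)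

(* Defs.v *)
From HB Require Import structures.
From mathcomp Require Import all_boot all_order all_algebra.
From mathcomp Require Import all_classical all_reals all_analysis.

Set Implicit Arguments.
Unset Strict Implicit.
Unset Printing Implicit Defensive.

Import Order.TTheory GRing.Theory Num.Theory.
Import numFieldNormedType.Exports.

Local Open Scope classical_set_scope.
Local Open Scope ring_scope.

Section OperatorNorm.
Variable R : realType.
Implicit Types V W : normedModType R.

Definition closed_unit_ball V : set V := [set x | `|x| <= 1].
Arguments closed_unit_ball V : clear implicits.

Definition unit_sphere V : set V := [set x | `|x| = 1].
Arguments unit_sphere V : clear implicits.

(* Since [sup] is the real-valued supremum, this is only meaningful for a
   bounded [T]; below it is always used together with [bounded_fun_norm T]. *)
Definition opnorm V W (T : {linear V -> W}) : R :=
  sup [set `|T x| | x in closed_unit_ball V].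

Definition operator_unit_sphere V : set {linear V -> V} :=
  [set T : {linear V -> V} | bounded_fun_norm T /\ opnorm T = 1].

End OperatorNorm.

Arguments closed_unit_ball {R} V.
Arguments unit_sphere {R} V.
Arguments operator_unit_sphere {R} V.

Section DavisWielandt.
Variables (R : realType) (X : normedModType R).

(* [R^o] is the scalar field as a normed module over itself, so that [opnorm f]
   is the dual norm of [f]. *)
Definition support_functionals (x : X) : set {linear X -> R^o} :=
  [set f : {linear X -> R^o} |
    [/\ bounded_fun_norm f, f x = 1 & opnorm f = 1]].

Definition norming_pairs : set (X * {linear X -> R^o}) :=
  [set p | unit_sphere X p.1 /\ support_functionals p.1 p.2].

Definition dw_radius (T : {linear X -> X}) : R :=
  sup [set Num.sqrt (`|p.2 (T p.1)| ^+ 2 + `|T p.1| ^+ 4)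
      | p in norming_pairs].

Definition dw_index : R :=
  inf [set dw_radius T | T in operator_unit_sphere X].

End DavisWielandt.

Section Polyhedral.
Variable R : realType.

Definition extreme_points (V : lmodType R) (A : set V) : set V :=
  [set x | A x /\ forall (y z : V) (t : R), A y -> A z -> 0 < t < 1 ->
    x = t *: y + (1 - t) *: z -> y = x /\ z = x].

Definition polyhedral (X : normedModType R) : Prop :=
  finite_set (extreme_points (closed_unit_ball X)).

Definition convex_hull (V : lmodType R) (A : set V) : set V :=
  smallest (@convex_set R V) A.

Definition polygon_vertex (n j : nat) : 'rV[R]_2 :=
  \row_(i < 2) if i == 0 then cos (j%:R * pi / n%:R)
               else sin (j%:R * pi / n%:R).

(* This is the solid polygon with 2n (not n) vertices, numbered from 0. *)
Definition regular_polygon (n : nat) : set 'rV[R]_2 :=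
  convex_hull [set polygon_vertex n j | j in [set j | (j < 2 * n)%N]].

End Polyhedral.

Arguments dw_index {R} X.
Arguments regular_polygon R n : clear implicits.

(* Main.v *)
Require Import Defs.
From HB Require Import structures.
From mathcomp Require Import all_boot all_order all_algebra.
From mathcomp Require Import all_classical all_reals all_analysis.
From mathcomp Require Import ring lra.

Set Implicit Arguments.
Unset Strict Implicit.
Unset Printing Implicit Defensive.

Import Order.TTheory GRing.Theory Num.Theory.
Import numFieldNormedType.Exports.

Local Open Scope classical_set_scope.
Local Open Scope ring_scope.

(** Write h = pi / 2n, so that the vertices are the points of the unit circle
    at the even multiples of h and the facets are orthogonal to the directions
    at the odd multiples of h.  Let J be the rotation by a right angle and put
    kappa = cos h for odd n and kappa = 1 for even n; the claimed value is
    sqrt ((kappa tan h)^2 + 1), since cos h tan h = sin h.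

    The number kappa^-1 is the polygonal norm of J v for every vertex v
    ([norm_quarter_turn]): if n is even, J v is again a vertex, and if n is odd,
    J v points to the middle of an edge, at Euclidean distance cos h from the
    centre.

    Lower bound ([dw_radius_unit_ge]).  By convexity an operator T of norm one
    satisfies |T v| = 1 at some vertex v.  The two facets adjacent to v provide
    two support functionals at v which, on y = a v + b J v, take the values
    a + tan h b and a - tan h b.  The larger absolute value is
    |a| + tan h |b|, and it is at least
    kappa tan h (|a| + |b| / kappa) >= kappa tan h |y|; the first step uses
    kappa tan h <= 1.  Apply this to y = T v ([face_forms_ge]).

    Upper bound ([dw_radius_quarter_turn]).  The operator kappa J has norm one
    and reaches the bound.  Let f support the ball at x.  The rotations Q by
    2h and -2h preserve the polygon, hence f (Q x) <= 1, that is,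
    cos 2h + sin 2h f (J x) <= 1 and cos 2h - sin 2h f (J x) <= 1.  Therefore
    |f (J x)| <= (1 - cos 2h) / sin 2h = tan h ([support_quarter_turn]). *)

(** * Operator norms *)

Section OperatorNormBounds.
Variables (R : realType) (V W : normedModType R).
Implicit Type T : {linear V -> W}.

Lemma linear_unit_ball_bound T M :
    (forall x, `|x| <= 1 -> `|T x| <= M) ->
  forall x, `|T x| <= M * `|x|.
Proof.
move=> TM x; have [->|x0] := eqVneq x 0; first by rewrite linear0 !normr0 mulr0.
have nx : 0 < `|x| by rewrite normr_gt0.
have := TM (`|x|^-1 *: x).
rewrite linearZ !normrZ normfV normr_id mulVf ?gt_eqF // => /(_ (lexx _)).
by rewrite mulrC ler_pdivrMr.
Qed.

Lemma opnorm_bound T :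
  bounded_fun_norm T -> forall x, `|T x| <= opnorm T * `|x|.
Proof.
move=> /(_ 1)[M TM]; apply: linear_unit_ball_bound => x x1.
apply: ub_le_sup; last by exists x.
by exists M => _ [y y1 <-]; exact: TM.
Qed.

Lemma opnorm_le T M : (forall x, `|T x| <= M * `|x|) -> 0 <= M -> opnorm T <= M.
Proof.
move=> TM M0; apply: ge_sup.
  by exists `|T 0|, 0 => //; rewrite /closed_unit_ball /= normr0.
move=> _ [x x1 <-]; apply: le_trans (TM x) _.
by rewrite ler_piMr.
Qed.

(** The shape in which both unit operators and support functionals arise: a
    nonexpansive map that preserves the norm of one unit vector. *)
Lemma opnorm_eq1 T x : (forall y, `|T y| <= `|y|) -> `|x| = 1 -> `|T x| = 1 ->
  bounded_fun_norm T /\ opnorm T = 1.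
Proof.
move=> T1 x1 Tx1; have bT : bounded_fun_norm T.
  by move=> r; exists r => y; exact: le_trans.
split=> //; apply/eqP; rewrite eq_le opnorm_le /= ?ler01 //; last first.
  by move=> y; rewrite mul1r.
by have := opnorm_bound bT x; rewrite x1 Tx1 mulr1.
Qed.

End OperatorNormBounds.

Section DavisWielandtBounds.
Variables (R : realType) (X : normedModType R).
Implicit Type T : {linear X -> X}.

Lemma support_functionals_bound (x : X) (f : {linear X -> R^o}) :
  support_functionals x f -> f x = 1 /\ forall y, `|f y| <= `|y|.
Proof.
by move=> [bf fx nf]; split=> // y; have := opnorm_bound bf y; rewrite nf mul1r.
Qed.

Lemma support_functionals_intro (x : X) (f : {linear X -> R^o}) :
  `|x| = 1 -> f x = 1 -> (forall y, `|f y| <= `|y|) -> support_functionals x f.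
Proof.
move=> x1 fx f1; have [|bf nf] := opnorm_eq1 f1 x1; first by rewrite fx normr1.
by split.
Qed.

(** The set of which the radius is the supremum is bounded by sqrt 2, because
    both |f (T y)| and |T y| are at most 1, so each of its elements is a lower
    bound of the radius. *)
Lemma dw_radius_ge T (x : X) (f : {linear X -> R^o}) :
    operator_unit_sphere X T -> `|x| = 1 -> support_functionals x f ->
  Num.sqrt (`|f (T x)| ^+ 2 + `|T x| ^+ 4) <= dw_radius T.
Proof.
move=> [bT nT] x1 fx; apply: ub_le_sup; last by exists (x, f).
exists (Num.sqrt 2) => _ [[y g] /= [y1 /support_functionals_bound[_ g1]] <-].
have Ty : `|T y| <= 1.
  by have := opnorm_bound bT y; rewrite nT mul1r [X in _ <= X]y1.
apply: ler_wsqrtr; rewrite (_ : 2 = 1 + 1) // lerD //.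
  by rewrite expr_le1 // (le_trans (g1 _)).
by rewrite expr_le1.
Qed.

Lemma dw_radius_le T M : @norming_pairs R X !=set0 ->
    (forall x (f : {linear X -> R^o}), `|x| = 1 -> support_functionals x f ->
      Num.sqrt (`|f (T x)| ^+ 2 + `|T x| ^+ 4) <= M) ->
  dw_radius T <= M.
Proof.
move=> [p pP] TM; apply: ge_sup; first by eexists; exists p.
by move=> _ [[x f] [/= x1 fx] <-]; exact: TM.
Qed.

End DavisWielandtBounds.

(** * Euclidean geometry of the plane *)

Section Plane.
Variable R : realType.
Implicit Types (a s t : R) (y : 'rV[R]_2).

Definition circle_point t : 'rV[R]_2 :=
  \row_(i < 2) if i == 0 then cos t else sin t.

(** The Euclidean scalar product with [circle_point s]. *)
Definition direction_form s y : R^o := cos s * y 0 0 + sin s * y 0 1.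

Lemma direction_form_linear s : linear (direction_form s).
Proof. by move=> k u v; rewrite /direction_form !mxE /GRing.scale /=; ring. Qed.

HB.instance Definition _ s :=
  GRing.isLinear.Build R 'rV[R]_2 R^o *:%R (direction_form s)
    (direction_form_linear s).

Definition rotation a y : 'rV[R]_2 :=
  \row_(i < 2) if i == 0 then cos a * y 0 0 - sin a * y 0 1
               else sin a * y 0 0 + cos a * y 0 1.

Lemma plane_eqP y (z : 'rV[R]_2) : y 0 0 = z 0 0 -> y 0 1 = z 0 1 -> y = z.
Proof.
move=> e0 e1; apply/rowP => i.
case: (unliftP 0 i) => [j ->|->//]; rewrite (ord1 j) (_ : lift 0 0 = 1) //.
exact/val_inj.
Qed.

Lemma rotation_linear a : linear (rotation a).
Proof. by move=> k u v; apply: plane_eqP; rewrite !mxE /=; ring. Qed.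

HB.instance Definition _ a :=
  GRing.isLinear.Build R 'rV[R]_2 'rV[R]_2 *:%R (rotation a)
    (rotation_linear a).

Lemma direction_form_circle s t : direction_form s (circle_point t) = cos (t - s).
Proof. by rewrite /direction_form !mxE /= cosB; ring. Qed.

Lemma rotation_circle a t : rotation a (circle_point t) = circle_point (t + a).
Proof.
by apply: plane_eqP; rewrite !mxE /= ?cosD ?sinD; ring.
Qed.

Lemma rotation_quarter a y : rotation a y = cos a *: y + sin a *: rotation (pi / 2) y.
Proof.
by apply: plane_eqP; rewrite !mxE /= cos_pihalf sin_pihalf; ring.
Qed.

Lemma direction_formD t a y :
  direction_form (t + a) y
  = cos a * direction_form t y + sin a * direction_form (t + pi / 2) y.
Proof. by rewrite /direction_form cosDpihalf sinDpihalf cosD sinD; ring. Qed.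

(** Coordinates in the orthonormal frame turned by the angle [t]. *)
Lemma circle_frame t y :
  y = direction_form t y *: circle_point t
      + direction_form (t + pi / 2) y *: circle_point (t + pi / 2).
Proof.
have e := sin2cos2 t.
apply: plane_eqP; rewrite !mxE /= /direction_form cosDpihalf sinDpihalf; ring: e.
Qed.

(** With [a] half the central angle of an edge, this places the middle of the
    edge at distance [cos a] from the centre. *)
Lemma circle_midpoint s a :
  circle_point (s + a) + circle_point (s - a) = (2 * cos a) *: circle_point s.
Proof.
by apply: plane_eqP; rewrite !mxE /= ?cosD ?sinD ?cosN ?sinN; ring.
Qed.

End Plane.

(** * Angles of the regular polygon *)

Section Angles.
Variables (R : realType) (n : nat).
Implicit Types (t : R) (z : int).

(** Half the central angle of an edge of the 2n-gon, that is, the angle between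
    a vertex and the normal of an adjacent edge. *)
Definition half_step : R := pi / (2 * n)%:R.

Lemma norm_cosD_mulpi t z : `|cos (t + z%:~R * pi)| = `|cos t|.
Proof.
have natD (k : nat) u : `|cos (u + k%:R * pi)| = `|cos u| :> R.
  by rewrite mulr_natl (alternatingn (@cosDpi R)) normrM normrX normrN1 expr1n mul1r.
case: z => k; first exact: natD.
by rewrite NegzE mulrNz -[in RHS](subrK (k.+1%:R * pi) t) natD mulNr.
Qed.

Lemma circle_pointD2pi t z : circle_point (t + z%:~R * (pi *+ 2)) = circle_point t.
Proof.
have natD (k : nat) u : circle_point (u + k%:R * (pi *+ 2)) = circle_point u :> 'rV[R]_2.
  rewrite mulr_natl; apply/rowP => i; rewrite !mxE.
  by rewrite (periodicn (@cosD2pi R)) (periodicn (@sinD2pi R)).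
case: z => k; first exact: natD.
by rewrite NegzE mulrNz -[in RHS](subrK (k.+1%:R * (pi *+ 2)) t) natD mulNr.
Qed.

Lemma cos_nonincreasing s t : 0 <= s -> s <= t -> t <= pi -> cos t <= cos s.
Proof.
move=> s0; rewrite le_eqVlt => /predU1P[->//|st tpi]; apply/ltW.
by rewrite ltr_cos // in_itv /=; apply/andP; split=> //;
  rewrite ?(le_trans s0) ?(le_trans _ tpi) ?ltW.
Qed.

Hypothesis n_gt1 : (1 < n)%N.

Let n_gt0 : 0 < n%:R :> R. Proof. by rewrite ltr0n ltnW. Qed.

Lemma half_stepE : n%:R * half_step = pi / 2.
Proof.
have n0 : n%:R != 0 :> R by rewrite gt_eqF.
by rewrite /half_step natrM; field.
Qed.

Lemma half_step_gt0 : 0 < half_step.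
Proof. by rewrite divr_gt0 ?pi_gt0 // ltr0n muln_gt0 (ltnW n_gt1). Qed.

Lemma half_step_le : half_step *+ 2 <= pi / 2.
Proof.
rewrite -half_stepE -[half_step *+ 2]mulr_natl ler_pM2r ?half_step_gt0 //.
by rewrite ler_nat.
Qed.

Lemma cos_half_step_gt0 : 0 < cos half_step.
Proof.
have h0 := half_step_gt0; have h1 := half_step_le.
by apply: cos_gt0_pihalf; apply/andP; split; lra.
Qed.

Lemma sin_half_step_gt0 : 0 < sin half_step.
Proof.
have h0 := half_step_gt0; have h1 := half_step_le.
by apply: sin_gt0_pi; apply/andP; split; lra.
Qed.

Lemma tan_half_step_gt0 : 0 < tan half_step.
Proof. by rewrite divr_gt0 ?sin_half_step_gt0 ?cos_half_step_gt0. Qed.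

(** The double of the angle is at most a right angle, so
    cos^2 - sin^2 = cos 2h is nonnegative. *)
Lemma tan_half_step_le1 : tan half_step <= 1.
Proof.
rewrite /tan ler_pdivrMr ?cos_half_step_gt0 // mul1r.
have h0 := half_step_gt0; have h1 := half_step_le.
have : 0 <= cos (half_step *+ 2) by apply: cos_ge0_pihalf; apply/andP; split; lra.
rewrite cos_mulr2n => c2; have s2 := sin2cos2 half_step.
have := cos_half_step_gt0; have := sin_half_step_gt0; nra.
Qed.

(** This says that the facet normals are dual to the vertices: among the odd
    multiples of h, those closest to a multiple of pi are at distance h.  Up to
    a multiple of pi the angle lies in [h, pi - h], since 2nh = pi. *)
Lemma cos_odd_half_step z :
  `|cos ((2 * z%:~R + 1) * half_step)| <= cos half_step.
Proof.
have nz : (n : int) != 0 by rewrite gt_eqF // ltz_nat ltnW.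
have [r er] : exists r : nat, (z %% n)%Z = r.
  by exists `|(z %% n)%Z|%N; rewrite gez0_abs // modz_ge0.
have rn : (r < n)%N by rewrite -ltz_nat -er ltz_pmod // ltz_nat ltnW.
have hn := half_stepE; have h0 := half_step_gt0.
(* Reduction of z modulo n shifts the angle by a multiple of pi. *)
rewrite (divz_eq z n) er intrD intrM.
rewrite (_ : _ * half_step =
    (2 * r%:R + 1) * half_step + (z %/ n)%Z%:~R * pi); last first.
  have hpi : pi = 2 * (n%:R * half_step) :> R by rewrite hn; field.
  by rewrite -!pmulrn hpi; ring.
rewrite norm_cosD_mulpi.
have r1 : r%:R + 1 <= n%:R :> R by rewrite natr1 ler_nat.
have r0 : 0 <= r%:R :> R by [].
have hr : r%:R * half_step + half_step <= n%:R * half_step.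
  by nra.
rewrite ler_norml; apply/andP; split.
  rewrite (_ : - cos half_step = cos (pi - half_step)).
    by apply: cos_nonincreasing; nra.
  by rewrite cosB cospi sinpi; ring.
by apply: cos_nonincreasing; nra.
Qed.

End Angles.

(** * The norm whose unit ball is the regular polygon *)

Section PolygonNorm.
Variables (R : realType) (n : nat) (X : normedModType R).
Variables (phi : {linear 'rV[R]_2 -> X}) (psi : {linear X -> 'rV[R]_2}).
Hypotheses (n_gt1 : (1 < n)%N) (phiK : cancel phi psi).
Hypothesis ball_polygon : closed_unit_ball X = phi @` regular_polygon R n.
Implicit Types (z : int) (x : X) (y : 'rV[R]_2).

Local Notation h := (half_step R n).

Let n_gt0 : (0 < n)%N. Proof. exact: ltnW. Qed.
Let c_gt0 : 0 < cos h. Proof. exact: cos_half_step_gt0. Qed.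

Lemma polygon_vertexE j :
  polygon_vertex R n j = circle_point (2 * j%:Z%:~R * h).
Proof.
have n0 : n%:R != 0 :> R by rewrite gt_eqF // ltr0n.
have -> : 2 * j%:Z%:~R * h = j%:R * pi / n%:R.
  by rewrite -pmulrn /half_step natrM; field.
by apply/rowP => i; rewrite !mxE.
Qed.

(** The vectors [x] with [|g x| <= M] form a convex set, so the operator norm
    of [g] is decided at the vertices. *)
Lemma norm_bound_vertices (W : normedModType R) (g : {linear X -> W}) M :
    (forall j : nat, (j < 2 * n)%N ->
      `|g (phi (circle_point (2 * j%:Z%:~R * h)))| <= M) ->
  forall x, `|g x| <= M * `|x|.
Proof.
move=> gM; apply: linear_unit_ball_bound => x x1.
have : closed_unit_ball X x by [].
rewrite ball_polygon => -[y yP <-].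
apply: (yP [set y | `|g (phi y)| <= M]); split; last first.
  by move=> _ [j jn <-]; rewrite /= polygon_vertexE; exact: gM.
move=> u v k /set_mem /= uM /set_mem /= vM; apply/mem_set => /=.
rewrite [phi _]linearD [phi (_ *: _)]linearZ [phi (_ *: _)]linearZ linearD !linearZ /=.
apply: le_trans (ler_normD _ _) _; rewrite !normrZ.
have k0 : 0 <= k%:num by [].
have k1 : 0 <= 1 - k%:num by rewrite subr_ge0.
rewrite !ger0_norm //.
apply: le_trans (lerD (ler_wpM2l k0 uM) (ler_wpM2l k1 vM)) _.
by rewrite -mulrDl addrC subrK mul1r.
Qed.

(** Vertices are indexed by all integers, so that rotations in both directions
    act on the indices by translation; periodicity brings the index back to
    the range [0, 2n). *)
Lemma norm_vertex_le1 z : `|phi (circle_point (2 * z%:~R * h))| <= 1.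
Proof.
have nz : ((2 * n)%N : int) != 0 by rewrite gt_eqF // ltz_nat muln_gt0.
have [r er] : exists r : nat, (z %% (2 * n)%N)%Z = r.
  by exists `|(z %% (2 * n)%N)%Z|%N; rewrite gez0_abs // modz_ge0.
have rn : (r < 2 * n)%N by rewrite -ltz_nat -er ltz_pmod // ltz_nat muln_gt0.
have hpi : pi *+ 2 = 2 * (2 * (n%:R * h)) :> R by rewrite half_stepE //; field.
have -> : 2 * z%:~R * h =
    2 * r%:Z%:~R * h + (z %/ (2 * n)%N)%Z%:~R * (pi *+ 2).
  by rewrite {1}(divz_eq z (2 * n)%N) er intrD intrM -!pmulrn natrM hpi; ring.
rewrite circle_pointD2pi -polygon_vertexE.
suff : closed_unit_ball X (phi (polygon_vertex R n r)) by [].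
rewrite ball_polygon; exists (polygon_vertex R n r) => //.
by apply: sub_gen_smallest; exists r.
Qed.

(** Rotations by even multiples of h permute the vertices. *)
Lemma norm_rotation_le z x : `|phi (rotation (2 * z%:~R * h) (psi x))| <= `|x|.
Proof.
rewrite -[leRHS]mul1r.
apply: (norm_bound_vertices (g := phi \o rotation (2 * z%:~R * h) \o psi)) => w _ /=.
rewrite phiK rotation_circle (_ : _ + _ = 2 * (w%:Z + z)%:~R * h) ?norm_vertex_le1 //.
by rewrite intrD; ring.
Qed.

(** For [s] an odd multiple of h, this functional equals 1 on the edge whose
    normal has angle [s]. *)
Definition face_form s : {linear X -> R^o} :=
  (cos h)^-1 \*: (direction_form s \o psi).

Lemma face_formE s x : face_form s x = (cos h)^-1 * direction_form s (psi x).
Proof. by []. Qed.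

Lemma norm_face_form_le z x :
  `|face_form ((2 * z%:~R + 1) * h) x| <= `|x|.
Proof.
rewrite -[leRHS]mul1r; apply: norm_bound_vertices => w _.
rewrite face_formE phiK direction_form_circle normrM normfV (gtr0_norm c_gt0).
rewrite ler_pdivrMl // mulr1 -cosN.
rewrite (_ : - _ = (2 * (z - w%:Z)%:~R + 1) * h) ?cos_odd_half_step //.
by rewrite intrB; ring.
Qed.

Lemma face_form_circle s t :
  face_form s (phi (circle_point t)) = (cos h)^-1 * cos (t - s).
Proof. by rewrite face_formE phiK direction_form_circle. Qed.

(** The functional of the edge following the vertex takes the value 1 there. *)
Lemma norm_vertex z : `|phi (circle_point (2 * z%:~R * h))| = 1.
Proof.
apply/eqP; rewrite eq_le norm_vertex_le1 /=.
apply: le_trans (norm_face_form_le z _).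
rewrite face_form_circle (_ : _ - _ = - h); last by ring.
by rewrite cosN mulVf ?gt_eqF // normr1.
Qed.

(** The scalar that brings a vertex turned by a right angle back to the unit
    sphere. *)
Definition quarter_scale : R := if odd n then cos h else 1.

Lemma quarter_scale_gt0 : 0 < quarter_scale.
Proof. by rewrite /quarter_scale; case: ifP. Qed.

(** For even n the turned vertex is a vertex.  For odd n it points at an odd
    multiple of h, the normal direction of an edge: the two ends of that edge
    bound the norm of its middle from above, and its own functional bounds it
    from below. *)
Lemma norm_quarter_turn z :
  `|phi (circle_point (2 * z%:~R * h + pi / 2))| = quarter_scale^-1.
Proof.
rewrite -(half_stepE R n_gt1) /quarter_scale.
have nE : n%:R = (odd n)%:R + 2 * (n./2)%:R :> R.
  by rewrite -natrM -natrD mul2n odd_double_half.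
case: ifP nE => _ -> /=; last first.
  rewrite invr1 (_ : _ + _ = 2 * (z + n./2)%:~R * h) ?norm_vertex //.
  by rewrite intrD -pmulrn; ring.
have ts : 2 * z%:~R * h + (1 + 2 * (n./2)%:R) * h = (2 * (z + n./2)%:~R + 1) * h.
  by rewrite intrD -pmulrn; ring.
rewrite ts; set s := (2 * _ + 1) * h; apply/eqP; rewrite eq_le; apply/andP; split.
  have := circle_midpoint s h => /(congr1 phi).
  rewrite linearD [phi (_ *: _)]linearZ /= => mid.
  rewrite -[leRHS]mul1r ler_pdivlMr //.
  have : `|(2 * cos h) *: phi (circle_point s)| <= 1 + 1.
    rewrite -mid (le_trans (ler_normD _ _)) // lerD //.
      rewrite (_ : s + h = 2 * (z + n./2 + 1)%:~R * h) ?norm_vertex_le1 //.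
      by rewrite /s [in RHS]intrD; ring.
    by rewrite (_ : s - h = 2 * (z + n./2)%:~R * h) ?norm_vertex_le1 // /s; ring.
  by rewrite normrZ gtr0_norm ?mulr_gt0 //; lra.
apply: le_trans (norm_face_form_le (z + n./2) _).
by rewrite face_form_circle subrr cos0 mulr1 ger0_norm // invr_ge0 ltW.
Qed.

End PolygonNorm.

(** * Davis-Wielandt radii in the polygonal norm *)

(** Lets the better of the two facets at a vertex be chosen. *)
Lemma sign_alignment (R : realDomainType) (u v : R) :
  exists2 e : R, e = 1 \/ e = -1 & `|u + e * v| = `|u| + `|v|.
Proof.
case: (ger0P u) => u0; case: (ger0P v) => v0;
  [exists 1|exists (-1)|exists (-1)|exists 1]; auto; rewrite ?mul1r ?mulN1r;
  case: (ger0P (u + _)); lra.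
Qed.

Section PolygonDavisWielandt.
Variables (R : realType) (n : nat) (X : normedModType R).
Variables (phi : {linear 'rV[R]_2 -> X}) (psi : {linear X -> 'rV[R]_2}).
Hypotheses (n_gt1 : (1 < n)%N) (phiK : cancel phi psi) (psiK : cancel psi phi).
Hypothesis ball_polygon : closed_unit_ball X = phi @` regular_polygon R n.
Implicit Types (T : {linear X -> X}) (x : X).

Local Notation h := (half_step R n).
Local Notation kappa := (quarter_scale R n).
Local Notation vertex z := (phi (circle_point (2 * z%:~R * h))).

Let c_gt0 : 0 < cos h. Proof. exact: cos_half_step_gt0. Qed.
Let s_gt0 : 0 < sin h. Proof. exact: sin_half_step_gt0. Qed.
Let t_gt0 : 0 < tan h. Proof. exact: tan_half_step_gt0. Qed.
Let k_gt0 : 0 < kappa. Proof. exact: quarter_scale_gt0. Qed.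
Let k_le1 : kappa <= 1.
Proof. by rewrite /quarter_scale; case: ifP => // _; exact: cos_le1. Qed.

Lemma face_form_support z s :
    (exists w : int, s = (2 * w%:~R + 1) * h) ->
    cos (2 * z%:~R * h - s) = cos h ->
  support_functionals (vertex z) (face_form n psi s).
Proof.
move=> [w sw] cs; apply: support_functionals_intro.
- exact: norm_vertex.
- by rewrite face_form_circle // cs mulVf ?gt_eqF.
- by move=> y; rewrite sw; exact: norm_face_form_le.
Qed.

(** A maximum over finitely many vertices, hence the norm of [T] is attained. *)
Lemma unit_operator_vertex T :
  operator_unit_sphere X T -> exists z : int, 1 <= `|T (vertex z)|.
Proof.
move=> [bT nT]; have n2 : (0 < 2 * n)%N by rewrite muln_gt0 (ltnW n_gt1).
pose F (j : 'I_(2 * n)) := `|T (vertex (j : nat))|.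
have [j _ jmax] := arg_maxP F (erefl : predT (Ordinal n2)).
exists (j : nat).
suff : opnorm T <= F j by rewrite nT.
apply: opnorm_le; last by rewrite /F.
apply: (norm_bound_vertices n_gt1 ball_polygon) => i i2.
exact: (jmax (Ordinal i2) isT).
Qed.

Definition quarter_turn : {linear X -> X} :=
  kappa \*: (phi \o rotation (pi / 2) \o psi).

Lemma quarter_turnE x : quarter_turn x = kappa *: phi (rotation (pi / 2) (psi x)).
Proof. by []. Qed.

Lemma norm_quarter_turn_vertex z : `|quarter_turn (vertex z)| = 1.
Proof.
rewrite quarter_turnE phiK rotation_circle normrZ (gtr0_norm k_gt0).
by rewrite (norm_quarter_turn n_gt1 phiK) // mulfV ?gt_eqF.
Qed.

Lemma norm_quarter_turn_le x : `|quarter_turn x| <= `|x|.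
Proof.
rewrite -[leRHS]mul1r; apply: (norm_bound_vertices n_gt1 ball_polygon) => z _.
by rewrite norm_quarter_turn_vertex.
Qed.

Lemma quarter_turn_unit : operator_unit_sphere X quarter_turn.
Proof.
apply: (@opnorm_eq1 _ _ _ _ (vertex 0)); first exact: norm_quarter_turn_le.
  exact: norm_vertex.
exact: norm_quarter_turn_vertex.
Qed.

(** The functional [f] is tested on [x] rotated by one step in each direction,
    which stays in the ball. *)
Lemma support_quarter_turn x (f : {linear X -> R^o}) :
    `|x| = 1 -> support_functionals x f ->
  `|f (quarter_turn x)| <= kappa * tan h.
Proof.
move=> x1 /support_functionals_bound[fx f1].
rewrite quarter_turnE linearZ normrZ (gtr0_norm k_gt0) ler_pM2l //.
set J := f _.
have rotJ z : cos (2 * z%:~R * h) + sin (2 * z%:~R * h) * J <= 1.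
  have : `|f (phi (rotation (2 * z%:~R * h) (psi x)))| <= 1.
    by rewrite -[leRHS]x1 (le_trans (f1 _)) // norm_rotation_le.
  rewrite rotation_quarter !linearD !linearZ /= psiK fx.
  by rewrite /GRing.scale /= mulr1 => /ler_normlW.
have := rotJ 1; have := rotJ (-1).
rewrite intrN mulr1 mulrN1 mulNr cosN sinN !mulr_natl cos_mulr2n sin_mulr2n.
move=> jm jp.
have e := sin2cos2 h.
(* By the double angle formulas, each test is the wanted bound on J cos h
   multiplied by 2 sin h. *)
rewrite /tan ler_pdivlMr // -[X in _ * X](gtr0_norm c_gt0) -normrM ler_norml.
apply/andP; split; rewrite -subr_le0 -(pmulr_rle0 _ s_gt0); nra.
Qed.

Lemma dw_radius_quarter_turn :
  dw_radius quarter_turn <= Num.sqrt ((kappa * tan h) ^+ 2 + 1).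
Proof.
apply: dw_radius_le.
  exists (vertex 0, face_form n psi h); split; first exact: norm_vertex.
  apply: face_form_support; first by exists 0; ring.
  by rewrite (_ : _ - h = - h) ?cosN //; ring.
move=> x f x1 fx; apply: ler_wsqrtr; apply: lerD.
  by rewrite lerXn2r ?nnegrE ?normr_ge0 ?support_quarter_turn // mulr_ge0 ?ltW.
by rewrite exprn_ile1 // -[leRHS]x1 norm_quarter_turn_le.
Qed.

(** One of the two facets at a vertex sees every vector [y] well: their values
    on [y] are a +- tan h b in the frame of the vertex, and the sign e of the
    facet is chosen so that nothing cancels. *)
Lemma face_forms_ge z y : exists2 f : {linear X -> R^o},
  support_functionals (vertex z) f & kappa * tan h * `|y| <= `|f y|.
Proof.
set t := 2 * z%:~R * h.
pose a := direction_form t (psi y); pose b := direction_form (t + pi / 2) (psi y).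
have yE : y = a *: vertex z + b *: phi (circle_point (t + pi / 2)).
  by rewrite -[LHS]psiK (circle_frame t (psi y)) linearD !linearZ.
have ny : `|y| <= `|a| + `|b| / kappa.
  rewrite {1}yE (le_trans (ler_normD _ _)) // !normrZ.
  by rewrite (norm_quarter_turn n_gt1 phiK) // (norm_vertex n_gt1 phiK) // mulr1.
have cy : kappa * tan h * `|y| <= `|a| + tan h * `|b|.
  have ck : kappa * tan h * (`|a| + `|b| / kappa) = kappa * tan h * `|a| + tan h * `|b|.
    by field; rewrite gt_eqF.
  apply: le_trans (ler_wpM2l _ ny) _; first by rewrite mulr_ge0 ?ltW.
  rewrite ck lerD2r ler_piMl // mulr_ile1 ?tan_half_step_le1 //; exact: ltW.
have [e ee ae] := sign_alignment a (tan h * b).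
have fE : face_form n psi (t + e * h) y = a + e * tan h * b.
  rewrite face_formE direction_formD -/a -/b /tan.
  have c0 : cos h != 0 by rewrite gt_eqF.
  by case: ee => ->; rewrite ?(mulN1r, mul1r, cosN, sinN); field.
exists (face_form n psi (t + e * h)).
  apply: face_form_support; last first.
    have -> : t - (t + e * h) = - (e * h) by ring.
    by rewrite cosN; case: ee => ->; rewrite ?mulN1r ?mul1r ?cosN.
  case: ee => ->; [exists z; rewrite /t; ring|exists (z - 1)].
  by rewrite /t intrB; ring.
by rewrite fE -[e * _ * _]mulrA ae normrM gtr0_norm.
Qed.

(** At a vertex where [T] attains its norm, the term |T v|^4 contributes 1 and
    the better of the two facet functionals contributes (kappa tan h)^2. *)
Lemma dw_radius_unit_ge T : operator_unit_sphere X T ->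
  Num.sqrt ((kappa * tan h) ^+ 2 + 1) <= dw_radius T.
Proof.
move=> Tu; have [z Tz] := unit_operator_vertex Tu.
have [f fz fT] := face_forms_ge z (T (vertex z)).
have c0 : 0 <= kappa * tan h by rewrite mulr_ge0 ?ltW.
have nz : `|vertex z| = 1 by exact: (norm_vertex n_gt1 phiK).
apply: le_trans (dw_radius_ge Tu nz fz); apply: ler_wsqrtr; apply: lerD.
  rewrite lerXn2r ?nnegrE ?normr_ge0 // (le_trans _ fT) //.
  exact: ler_peMr.
exact: exprn_ege1.
Qed.

End PolygonDavisWielandt.

Theorem theorem3p8 (R : realType) (n : nat) (hn : (2 <= n)%N)
    (X : completeNormedModType R)
    (phi : {linear 'rV[R]_2 -> X}) (phi_bij : bijective phi)
    (hpoly : polyhedral X)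
    (hball : closed_unit_ball X = phi @` regular_polygon R n) :
  dw_index X =
    if odd n then Num.sqrt (sin (pi / (2 * n)%:R) ^+ 2 + 1)
    else Num.sqrt (tan (pi / (2 * n)%:R) ^+ 2 + 1).
Proof.
rewrite -/(half_step R n).
have -> : (if odd n then Num.sqrt (sin (half_step R n) ^+ 2 + 1)
           else Num.sqrt (tan (half_step R n) ^+ 2 + 1))
        = Num.sqrt ((quarter_scale R n * tan (half_step R n)) ^+ 2 + 1).
  rewrite /quarter_scale; case: ifP => _; last by rewrite mul1r.
  by rewrite /tan mulrC divfK // gt_eqF // cos_half_step_gt0.
have [psi phiK psiK] := phi_bij.
pose Psi : {linear X -> 'rV[R]_2} :=
  HB.pack psi (GRing.isLinear.Build R X 'rV[R]_2 *:%R psi (can2_linear phiK psiK)).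
have PsiK : cancel phi Psi by [].
have phiPsi : cancel Psi phi by [].
pose Q := quarter_turn n phi Psi.
have QS : operator_unit_sphere X Q by exact: quarter_turn_unit.
have dw_ge T : operator_unit_sphere X T ->
    Num.sqrt ((quarter_scale R n * tan (half_step R n)) ^+ 2 + 1) <= dw_radius T.
  exact: (dw_radius_unit_ge hn PsiK phiPsi hball).
apply/eqP; rewrite eq_le; apply/andP; split.
  apply: le_trans (dw_radius_quarter_turn hn PsiK phiPsi hball).
  apply: ge_inf; last by exists Q.
  by exists 0 => _ [T TS <-]; exact: le_trans (sqrtr_ge0 _) (dw_ge T TS).
apply: lb_le_inf; first by exists (dw_radius Q), Q.
by move=> _ [T TS <-]; exact: dw_ge.
Qed.
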